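(* For $i=1,2$ and $j=3-i$, let $X_{i,o}\subset\mathbb R$ be a closed bounded interval, let $\theta_i\in\mathbb R$, and let $u_i(x,\theta_i)$, $x=(x_1,x_2)\in X_{1,o}\times X_{2,o}$, be the real-valued reward of player $i$, which is continuous in $(x,\theta_i)$ and has a unique maximizer $x_i(x_j,\theta_i)$ over $x_i\in X_{i,o}$ for every $(x_j,\theta_i)$; assume also that the full information game $\mathcal G_o$ with these rewards has at least one pure Nash equilibrium. Assume that, for $i=1,2$, the best response $r_i(X_j,\theta_i,\pi_i)$ is single-valued and continuous in $X_j$, $\theta_i$ and $\pi_i$. If $\Theta_i=\{\theta_i\}$ for $i=1,2$, then the uncertainty equilibrium $(X_1^*(\pi),X_2^*(\pi))$ of the game $\mathcal G(\pi)$ with attitudes $\pi$ coincides with the Nash equilibrium $(x_1^\star,x_2^\star)$ of $\mathcal G_o$, irrespective of $\pi\in[0,1]^2$; that is, the uncertainty equilibria of $\mathcal G(\pi)$ are the pairs $(\{x_1^\star\},\{x_2^\star\})$ with $(x_1^\star,x_2^\star)$ a pure Nash equilibrium of $\mathcal G_o$.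
   Context: $\mathcal G_o$ is the game in which player $i$ chooses $x_i\in X_{i,o}$ and gets $u_i(x,\theta_i)$, with $u_i$, $X_{i,o}$, $\theta_i$ common knowledge. $\mathcal G(\pi)$: player $i$ knows her type $\theta_i\in\Theta_i$ but only that $\theta_j\in\Theta_j$; this is common knowledge. Player $i$ has an attitude $\pi_i\in[0,1]$. If player $i$ believes $x_j\in X_j\subset X_{j,o}$, she maximizes over $x_i\in X_{i,o}$ the quantity $$f_i(x_i,X_j,\theta_i,\pi_i)=\pi_i\max_{x_j\in X_j}u_i(x,\theta_i)+(1-\pi_i)\min_{x_j\in X_j}u_i(x,\theta_i).$$ The best response is $r_i(X_j,\theta_i,\pi_i)=\arg\max_{x_i\in X_{i,o}}f_i(x_i,X_j,\theta_i,\pi_i)$, and $\psi_i(X_j;\pi_i)=\bigcup_{\theta_i\in\Theta_i}r_i(X_j,\theta_i,\pi_i)$. Here $X_j$ ranges over nonempty closed subintervals of $X_{j,o}$ (possibly single points), and continuity in $X_j$ means continuity in the interval's endpoints. A pair of sets $(X_1,X_2)$ is an uncertainty equilibrium of $\mathcal G(\pi)$ if $X_i=\psi_i(X_j;\pi_i)$ for $i=1,2$ and $j=3-i$. *)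

(* Defs.v *)
From mathcomp Require Export all_boot all_order all_algebra.
From mathcomp Require Export all_classical all_reals all_analysis.
Export Order.TTheory GRing.Theory Num.Theory.
Export numFieldNormedType.Exports.


#[export] Set Implicit Arguments.
#[export] Unset Strict Implicit.
#[export] Unset Printing Implicit Defensive.

Open Scope classical_set_scope.
Open Scope ring_scope.

Inductive player := P1 | P2.

Definition opponent (i : player) : player :=
  match i with P1 => P2 | P2 => P1 end.

Definition coord (T : Type) (i : player) (x : T * T) : T :=
  match i with P1 => x.1 | P2 => x.2 end.

(* The profile (x_1, x_2) in which player i plays xi and her opponent xj. *)
Definition profile (T : Type) (i : player) (xi xj : T) : T * T :=
  match i with P1 => (xi, xj) | P2 => (xj, xi) end.

Section Games.
Variable R : realType.
Implicit Types (A X Y : set R) (i : player).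

Definition closed_bounded_interval A : Prop :=
  exists a b : R, a <= b /\ A = `[a, b]%classic.

Definition closed_subinterval A X : Prop :=
  closed_bounded_interval X /\ X `<=` A.

(* The largest (smallest) element of A; the default 0 is returned only when
   there is none, which does not happen for the image of a nonempty compact set
   under a continuous function. *)
Definition maximum A : R := xget 0 (A `&` ubound A).
Definition minimum A : R := xget 0 (A `&` lbound A).

Definition argmax A (g : R -> R) : set R :=
  [set x | A x /\ forall y, A y -> g y <= g x].

(* Only the values of u i x t with x in Xo P1 `*` Xo P2 are meaningful. *)
Variables (Xo : player -> set R) (u : player -> R * R -> R -> R).

Definition nash_equilibrium (theta : player -> R) (x : R * R) : Prop :=
  forall i, Xo i (coord i x) /\
    forall y, Xo i y ->
      u i (profile i y (coord (opponent i) x)) (theta i) <= u i x (theta i).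

Definition continuous_reward i : Prop :=
  {within [set p : (R * R) * R | (Xo P1 `*` Xo P2) p.1],
    continuous (fun p : (R * R) * R => u i p.1 p.2)}.

Definition unique_maximizer i : Prop :=
  forall xj t : R, Xo (opponent i) xj ->
    exists! xi, argmax (Xo i) (fun y => u i (profile i y xj) t) xi.

Definition objective i (xi : R) (Xj : set R) (t p : R) : R :=
  p * maximum [set u i (profile i xi xj) t | xj in Xj] +
  (1 - p) * minimum [set u i (profile i xi xj) t | xj in Xj].

Definition best_response i (Xj : set R) (t p : R) : set R :=
  argmax (Xo i) (fun xi => objective i xi Xj t p).

(* Joint continuity in the endpoints c, d of the interval `[c, d], the type t
   and the attitude p; a point of the domain is (c, d, t, p). *)
Definition single_valued_continuous_best_response i : Prop :=
  exists rho : R * R * R * R -> R,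
    let D := [set z : R * R * R * R |
      let: (c, d, t, p) := z in
      [/\ c <= d, `[c, d]%classic `<=` Xo (opponent i) & 0 <= p <= 1]] in
    (forall c d t p, D (c, d, t, p) ->
       best_response i `[c, d]%classic t p = [set rho (c, d, t, p)]) /\
    {within D, continuous rho}.

Definition uncertain_response (Theta : player -> set R) i (Xj : set R) (p : R) :
    set R :=
  \bigcup_(t in Theta i) best_response i Xj t p.

Definition uncertainty_equilibrium (Theta : player -> set R)
    (att : player -> R) (X : set R * set R) : Prop :=
  forall i, closed_subinterval (Xo i) (coord i X) /\
    coord i X = uncertain_response Theta i (coord (opponent i) X) (att i).

End Games.

(* Main.v *)
(** With degenerate type sets the equilibrium condition reads
    [X_i = best_response i X_j], and the best response to an interval is a
    single point. So both sets are singletons, against which the best and the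
    worst case agree and the objective is the reward itself, whatever [pi]. *)
Require Import Defs.

Section DegenerateTypes.
Variable R : realType.
Implicit Types (A X : set R) (i : player).

Lemma maximum_set1 (v : R) : maximum [set v] = v.
Proof.
apply: xget_unique => [|y [-> //]].
by split=> // y ->.
Qed.

Lemma minimum_set1 (v : R) : minimum [set v] = v.
Proof.
apply: xget_unique => [|y [-> //]].
by split=> // y ->.
Qed.

Variables (Xo : player -> set R) (u : player -> R * R -> R -> R).

Lemma objective_set1 i (xi xj t p : R) :
  objective u i xi [set xj] t p = u i (profile i xi xj) t.
Proof.
by rewrite /objective image_set1 maximum_set1 minimum_set1 -mulrDl subrKC mul1r.
Qed.

Lemma best_response_set1 i (xj t p : R) :
  best_response Xo u i [set xj] t p =
  argmax (Xo i) (fun y => u i (profile i y xj) t).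
Proof.
by congr argmax; apply/funext => y; rewrite objective_set1.
Qed.

Lemma profile_coord i (x : R * R) :
  profile i (coord i x) (coord (opponent i) x) = x.
Proof. by case: i x => [] []. Qed.

(** Gives the Nash condition the [argmax] form that [best_response_set1] produces, so that both
    equilibrium notions can be compared player by player. *)
Lemma nash_equilibriumP (theta : player -> R) (x : R * R) :
  nash_equilibrium Xo u theta x <->
  forall i, argmax (Xo i)
    (fun y => u i (profile i y (coord (opponent i) x)) (theta i)) (coord i x).
Proof.
by split=> h i; have [hi hmax] := h i; split=> // y /hmax; rewrite profile_coord.
Qed.

(** The endpoints of [X] and the pair [t], [p] form a point in the domain of [rho], whose value
    there is the only best response. *)
Lemma best_response_interval i X (t p : R) :
  single_valued_continuous_best_response Xo u i ->
  closed_subinterval (Xo (opponent i)) X -> 0 <= p <= 1 ->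
  exists x, best_response Xo u i X t p = [set x].
Proof.
move=> [rho [hrho _]] [[c [d [cd ->]]] sub] hp.
by exists (rho (c, d, t, p)); apply: hrho; split.
Qed.

Lemma closed_subinterval_set1 A (x : R) : A x -> closed_subinterval A [set x].
Proof.
move=> Ax; split; last by move=> y ->.
by exists x, x; rewrite lexx set_itv1.
Qed.

End DegenerateTypes.

Theorem theorem6 (R : realType) (Xo : player -> set R) (theta : player -> R)
  (u : player -> R * R -> R -> R)
  (hXo : forall i, closed_bounded_interval (Xo i))
  (hu : forall i, continuous_reward Xo u i)
  (hmax : forall i, unique_maximizer Xo u i)
  (hnash : exists x, nash_equilibrium Xo u theta x)
  (hbr : forall i, single_valued_continuous_best_response Xo u i)
  (Theta : player -> set R)
  (hTheta : forall i, Theta i = [set theta i])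
  (att : player -> R)
  (hatt : forall i, 0 <= att i <= 1)
  (X1 X2 : set R) :
  uncertainty_equilibrium Xo u Theta att (X1, X2) <->
  exists x1 x2 : R,
    [/\ nash_equilibrium Xo u theta (x1, x2), X1 = [set x1] & X2 = [set x2]].
Proof.
have respE i X : uncertain_response Xo u Theta i X (att i) =
    best_response Xo u i X (theta i) (att i).
  by rewrite /uncertain_response hTheta bigcup_set1.
split=> [eqX | [x1 [x2 [/nash_equilibriumP nashx -> ->]]]].
- have singleton i : exists x, coord i (X1, X2) = [set x].
    (* The equation for [i] turns her set into a response; the opponent's half of the equilibrium
       makes the set responded to an interval. *)
    have [_ ->] := eqX i; have [subj _] := eqX (opponent i).
    by rewrite respE; apply: best_response_interval.
  have [x1 /= X1E] := singleton P1; have [x2 /= X2E] := singleton P2.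
  exists x1, x2; split=> //; apply/nash_equilibriumP => i.
  have [_] := eqX i; rewrite respE X1E X2E.
  (* The [argmax] set is now a singleton, and what remains is that it contains its own point. *)
  by case: i => /=; rewrite best_response_set1 => <-.
- have coord1 i : coord i ([set x1], [set x2]) = [set coord i (x1, x2)].
    by case: i.
  move=> i; rewrite !coord1 respE best_response_set1.
  split; first by apply: closed_subinterval_set1; have [] := nashx i.
  have [Xoj _] := nashx (opponent i).
  (* Nash only puts player [i]'s strategy in the [argmax]; that nothing else lies there comes from
     uniqueness of the maximizer [y], with which every element of the [argmax] coincides. *)
  have [y [_ uniq_y]] := hmax i _ (theta i) Xoj.
  apply/seteqP; split=> [_ -> //|z /uniq_y <-].
  exact: uniq_y (nashx i).
Qed.
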